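(* Assume Conjecture 1 (stated in the context). Let $\delta>0$ be fixed. Then for every integer $y\ge 1$ there exists $x_0(\delta,y)$ such that for all integers $x\ge x_0(\delta,y)$, $$W(x,y)\le (1+\delta)\frac{\log x}{\log\log x}.$$
   Context: $\mathbb{N}$ denotes the positive integers and $\log$ the natural logarithm. For $n\in\mathbb{N}$, $\omega(n)$ is the number of distinct prime divisors of $n$ and $\gamma(n):=\prod_{p\mid n}p$ is the product of the distinct primes dividing $n$ (so $\gamma(1)=1$). Define $$H(n):=\frac{\gamma(n)}{(\log\gamma(n))^{\omega(n)}}\qquad(n\in\mathbb{N}),$$ with the convention $0^0=1$, so that $H(1)=1$. For $y\in\mathbb{N}$ and $x\in\mathbb{Z}_{\ge 0}$ define $$W(x,y):=\sum_{j=1}^{y}\omega(x+j).$$ Conjecture 1 is the following statement: for every $\epsilon>0$ there exists a constant $C(\epsilon)$ such that for all $(a,b,c)\in\mathbb{N}^3$ with $\gcd(a,b,c)=1$ and $a+b=c$, one has $c<C(\epsilon)\,H(abc)^{1+\epsilon}$. *)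

(* Defs.v *)
From mathcomp Require Import all_boot all_order all_algebra.
From mathcomp Require Import all_classical all_reals all_analysis.
Set Implicit Arguments.
Unset Strict Implicit.
Unset Printing Implicit Defensive.
Import Order.TTheory GRing.Theory Num.Theory.
Local Open Scope ring_scope.

Definition omega (n : nat) : nat := size (primes n).

Definition gamma (n : nat) : nat := (\prod_(p <- primes n) p)%N.

(* The exponent is a natural number and [x ^+ 0 = 1] for every [x], so the
   convention 0^0 = 1 is built in: [H R 1 = 1] although [ln 1 = 0]. *)
Definition H (R : realType) (n : nat) : R :=
  (gamma n)%:R / ln (gamma n)%:R ^+ omega n.

Definition W (x y : nat) : nat := (\sum_(1 <= j < y.+1) omega (x + j))%N.

Definition refined_abc_conjecture (R : realType) : Prop :=
  forall eps : R, 0 < eps ->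
  exists C : R, forall a b c : nat,
    (0 < a)%N -> (0 < b)%N -> (0 < c)%N ->
    gcdn (gcdn a b) c = 1%N -> (a + b)%N = c ->
    c%:R < C * H R (a * b * c) `^ (1 + eps).

(* Main.v *)
Require Import Defs.
From mathcomp Require Import all_boot all_order all_algebra.
From mathcomp Require Import all_classical all_reals all_analysis.
From mathcomp Require Import zify ring lra.
Set Implicit Arguments.
Unset Strict Implicit.
Unset Printing Implicit Defensive.
Import Order.TTheory GRing.Theory Num.Theory.
Import numFieldNormedType.Exports.
Local Open Scope ring_scope.

(* Let p = x + 1 and let U and V be the products of the (p + k)^C(m, k) over
   the even, resp. odd, k <= m, where m = y. Then ln U - ln V is the m-th
   difference of ln at p, which is negative and O(p^(-m)), so that
   0 < V - U = O(V / p^m). Apply the conjecture to U + (V - U) = V divided by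
   g = gcd(U, V), which is bounded. With c = V / g, the radical r of the triple
   is at most prod_(k <= m) (p + k) * (V - U) / g = O(p c), so the conjecture
   gives (ln r)^w = O(p c^eps), where w is the number of primes of the triple,
   c = O(p^(2^(m - 1))) and ln r >= (ln p) / 4. Taking logarithms bounds w,
   hence W(x, y) <= w + O(1). *)

(** * Divisibility of products and radicals *)

Lemma gcdn_mul_dvd (a b c : nat) : (gcdn (a * b) c %| gcdn a c * gcdn b c)%N.
Proof.
rewrite muln_gcdr !muln_gcdl !dvdn_gcd dvdn_gcdl.
by rewrite !(dvdn_mull _ (dvdn_gcdr _ _)) ?(dvdn_mulr _ (dvdn_gcdr _ _)).
Qed.

Lemma gcdn_prod_dvd (I : Type) (s : seq I) (F : I -> nat) (c : nat) :
  (gcdn (\prod_(i <- s) F i) c %| \prod_(i <- s) gcdn (F i) c)%N.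
Proof.
elim: s => [|i s IH]; first by rewrite !big_nil gcd1n.
by rewrite !big_cons (dvdn_trans (gcdn_mul_dvd _ _ _))// dvdn_mul.
Qed.

Lemma leq_prod_pow (I : eqType) (s : seq I) (F : I -> nat) (M : nat) :
  (forall i, i \in s -> F i <= M)%N -> (\prod_(i <- s) F i <= M ^ size s)%N.
Proof.
elim: s => [|i s IH] h; first by rewrite big_nil.
rewrite big_cons expnS leq_mul ?h ?mem_head// IH// => j js.
by rewrite h// inE js orbT.
Qed.

Lemma pow_leq_prod (I : eqType) (s : seq I) (F : I -> nat) (M : nat) :
  (forall i, i \in s -> M <= F i)%N -> (M ^ size s <= \prod_(i <- s) F i)%N.
Proof.
elim: s => [|i s IH] h; first by rewrite big_nil.
rewrite big_cons expnS leq_mul ?h ?mem_head// IH// => j js.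
by rewrite h// inE js orbT.
Qed.

Lemma prime_dvd_prod (I : eqType) (s : seq I) (F : I -> nat) (q : nat) :
  prime q -> (q %| \prod_(i <- s) F i)%N -> exists2 i, i \in s & (q %| F i)%N.
Proof.
move=> pq; elim: s => [|i s IH].
  by rewrite big_nil dvdn1 => /eqP q1; rewrite q1 in pq.
rewrite big_cons Euclid_dvdM// => /orP[qi|/IH[j js qj]].
  by exists i; rewrite ?mem_head.
by exists j; rewrite // inE js orbT.
Qed.

Lemma prod_gt0_seq (I : eqType) (s : seq I) (F : I -> nat) :
  (forall i, i \in s -> 0 < F i)%N -> (0 < \prod_(i <- s) F i)%N.
Proof. by move=> h; rewrite big_seq prodn_cond_gt0. Qed.

Lemma dvdn_prod_seq (I : eqType) (s : seq I) (F : I -> nat) i :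
  i \in s -> (F i %| \prod_(i <- s) F i)%N.
Proof. by move=> si; rewrite (big_rem i)//= dvdn_mulr. Qed.

(** Distinct primes are pairwise coprime, so their product divides whatever each of them divides. *)
Lemma gamma_dvd (n M : nat) :
  (forall q, prime q -> q %| n -> q %| M)%N -> (0 < n)%N -> (gamma n %| M)%N.
Proof.
move=> h n0; rewrite /gamma.
have: {in primes n, forall q, prime q && (q %| M)}%N.
  by move=> q; rewrite mem_primes => /and3P[pq _ qn]; rewrite pq h.
elim: (primes n) (primes_uniq n) => [|q s IH]/=; first by rewrite big_nil.
move=> /andP[qs us] hs; rewrite big_cons Gauss_dvd; last first.
  have /andP[pq _] := hs q (mem_head _ _); rewrite prime_coprime//.
  apply/negP => /(prime_dvd_prod pq)[r rs qr].
  have /andP[pr _] := hs r (mem_behead (s := q :: s) rs).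
  by move: qr; rewrite dvdn_prime2// => /eqP qr; rewrite qr rs in qs.
have /andP[_ ->] := hs q (mem_head _ _); apply: IH => // r rs.
exact/hs/(mem_behead (s := q :: s)).
Qed.

Lemma gamma_ge_pow2 (n : nat) : (2 ^ omega n <= gamma n)%N.
Proof.
apply: pow_leq_prod => q; rewrite mem_primes => /and3P[pq _ _].
exact: prime_gt1.
Qed.

(** * Prime divisors of consecutive integers *)

Lemma eq_mod_small (q p i j : nat) : (i < q)%N -> (j < q)%N ->
  (q %| p + i)%N -> (q %| p + j)%N -> i = j.
Proof.
move=> iq jq /eqP hi /eqP hj.
have : (p + i == p + j %[mod q])%N by rewrite hi hj.
by rewrite eqn_modDl !modn_small// => /eqP.
Qed.

(* A prime larger than [m] divides at most one of the [m.+1] consecutive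
   integers, so only primes up to [m] are counted with multiplicity. *)
Lemma sum_omega_le (p m n : nat) : (0 < p)%N -> (0 < n)%N ->
  (forall q j, prime q -> m < q -> j <= m -> q %| p + j -> q %| n)%N ->
  (\sum_(0 <= j < m.+1) omega (p + j) <= omega n + m.+1 * m)%N.
Proof.
move=> p0 n0 hn; pose big j := [seq q <- primes (p + j) | (m < q)%N].
have omegaE j : (omega (p + j) <= size (big j) + m)%N.
  rewrite /omega -(count_predC (fun q => m < q)%N) size_filter leq_add2l -size_filter.
  rewrite -{2}(size_iota 1 m); apply: uniq_leq_size.
    by rewrite filter_uniq// primes_uniq.
  move=> q; rewrite mem_filter mem_primes /= -leqNgt mem_iota add1n ltnS.
  by move=> /and3P[-> /prime_gt0 -> _].
(* The lists [big j] for distinct [j <= m] are disjoint by [eq_mod_small], so they concatenate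
   without repetition. *)
have sum_big k : (k <= m.+1)%N ->
    exists s : seq nat, [/\ uniq s, size s = (\sum_(0 <= j < k) size (big j))%N
      & forall q, q \in s ->
        [/\ prime q, (m < q)%N & exists2 j, (j < k)%N & (q %| p + j)%N]].
  elim: k => [|k IH] km; first by exists [::]; rewrite big_nil.
  have [s [us ss hs]] := IH (ltnW km); exists (s ++ big k); split.
  - rewrite cat_uniq us filter_uniq ?primes_uniq// andbT.
    apply/hasPn => q; rewrite mem_filter mem_primes /= => /and4P[mq pq _ qk].
    apply/negP => /hs[_ _ [j jk qj]].
    have := @eq_mod_small q p k j; rewrite (leq_trans km)//.
    by move=> /(_ isT) jkE; move: (jk); rewrite jkE ?ltnn//; lia.
  - by rewrite size_cat ss big_nat_recr.
  - move=> q; rewrite mem_cat => /orP[/hs[pq mq [j jk qj]]|].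
      by split => //; exists j => //; rewrite ltnS ltnW.
    rewrite mem_filter mem_primes /= => /and4P[mq pq _ qk].
    by split => //; exists k.
have [s [us ss hs]] := sum_big m.+1 (leqnn _).
apply: (@leq_trans (\sum_(0 <= j < m.+1) (size (big j) + m))%N).
  exact: leq_sum.
rewrite big_split /= -ss sum_nat_const_nat subn0 leq_add2r.
apply: uniq_leq_size => // q /hs[pq mq [j jm qj]].
by rewrite mem_primes pq n0 (hn q j).
Qed.

(** * Even and odd products of consecutive integers, and their abc triple *)

(* [diff_idx b m] lists the [k <= m] of parity [b], each with multiplicity
   ['C(m, k)]: it holds the shifts of sign [(-1)^b] in the [m]-th difference. *)
Fixpoint diff_idx (b : bool) (m : nat) : seq nat :=
  if m is m'.+1 then diff_idx b m' ++ map S (diff_idx (~~ b) m')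
  else if b then [::] else [:: 0%N].

Lemma diff_idx_mem b m i :
  (i \in diff_idx b m) = (i <= m)%N && (odd i == b).
Proof.
elim: m b i => [|m IH] b i /=; first by case: b; case: i => [|[]].
rewrite mem_cat IH; case: i => [|i].
  by rewrite /= -[RHS]orbF; congr orb; apply/mapP => -[].
rewrite mem_map ?IH; last by move=> ? ? [].
rewrite /= ltnS; case: (odd i); case: b => /=; lia.
Qed.

(** The binomial coefficients of even and of odd index have equal sums in every row but row 0, hence
    the order [m.+1] from here on. *)
Lemma size_diff_idx b m : size (diff_idx b m.+1) = (2 ^ m)%N.
Proof.
elim: m b => [|m IH] b; first by case: b.
by rewrite [diff_idx _ _]/= -/(diff_idx _ m.+1) -/(diff_idx _ m.+1)
  size_cat size_map !IH expnS mul2n addnn.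
Qed.

Definition diff_prod (b : bool) (m p : nat) : nat :=
  (\prod_(i <- diff_idx b m) (p + i))%N.

Lemma diff_prod_le b m p : (diff_prod b m.+1 p <= (p + m.+1) ^ (2 ^ m))%N.
Proof.
rewrite -(size_diff_idx b); apply: leq_prod_pow => i.
by rewrite diff_idx_mem => /andP[im _]; rewrite leq_add2l.
Qed.

Lemma diff_prod_ge b m p : (p ^ (2 ^ m) <= diff_prod b m.+1 p)%N.
Proof.
by rewrite -(size_diff_idx b); apply: pow_leq_prod => i _; rewrite leq_addr.
Qed.

(** Each side has [2 ^ m] factors, and a factor with even shift and one with odd shift have gcd at
    most [m.+1]: for a larger gcd, [eq_mod_small] would make the two shifts equal. *)
Lemma gcdn_diff_prod m p : (0 < p)%N ->
  (gcdn (diff_prod false m.+1 p) (diff_prod true m.+1 p)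
    <= m.+1 ^ (2 ^ m * 2 ^ m))%N.
Proof.
move=> p0.
have step i : i \in diff_idx false m.+1 ->
    (gcdn (p + i) (diff_prod true m.+1 p) <= m.+1 ^ (2 ^ m))%N.
  rewrite diff_idx_mem => /andP[im /eqP oi]; rewrite gcdnC.
  apply: leq_trans (dvdn_leq _ (gcdn_prod_dvd _ _ _)) _.
    by apply: prod_gt0_seq => j _; rewrite gcdn_gt0; lia.
  rewrite -(size_diff_idx true); apply: leq_prod_pow => j.
  rewrite diff_idx_mem => /andP[jm /eqP oj]; rewrite leqNgt; apply/negP => h.
  have ij := @eq_mod_small _ p _ _ (leq_ltn_trans im h) (leq_ltn_trans jm h)
               (dvdn_gcdr _ _) (dvdn_gcdl _ _).
  by rewrite ij oj in oi.
apply: leq_trans (dvdn_leq _ (gcdn_prod_dvd _ _ _)) _.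
  by apply: prod_gt0_seq => j _; rewrite gcdn_gt0; lia.
by rewrite expnM -{2}(size_diff_idx false); apply: leq_prod_pow.
Qed.

Lemma prime_dvd_diff_prod b m p q : prime q -> (q %| diff_prod b m p)%N ->
  exists j, [/\ (j <= m)%N, odd j = b & (q %| p + j)%N].
Proof.
move=> pq /(prime_dvd_prod pq)[j].
by rewrite diff_idx_mem => /andP[jm /eqP <-] qj; exists j.
Qed.

(** The triple is U/g, (V - U)/g, V/g with g = gcd(U, V). The last identity serves to carry a bound
    on V - U over to [b]. *)
Lemma abc_triple_of_diff (m p : nat) (U := diff_prod false m.+1 p)
    (V := diff_prod true m.+1 p) : (0 < p)%N -> (U < V)%N ->
  exists a b c : nat,
    [/\ (0 < a)%N, (0 < b)%N, gcdn (gcdn a b) c = 1%N & (a + b)%N = c] /\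
    [/\ (\sum_(0 <= j < m.+2) omega (p + j)
           <= omega (a * b * c) + m.+2 * m.+1)%N,
        (gamma (a * b * c) <= (p + m.+1) ^ m.+2 * b)%N,
        (p ^ (2 ^ m) <= m.+1 ^ (2 ^ m * 2 ^ m) * c)%N,
        (c <= (p + m.+1) ^ (2 ^ m))%N & (b * V = c * (V - U))%N].
Proof.
move=> p0 UV; set g := gcdn U V.
have U0 : (0 < U)%N by apply: prod_gt0_seq => i _; lia.
have g0 : (0 < g)%N by rewrite gcdn_gt0 U0.
have /dvdnP[a Ua] : (g %| U)%N by rewrite dvdn_gcdl.
have /dvdnP[c Vc] : (g %| V)%N by rewrite dvdn_gcdr.
have ac : (a < c)%N by rewrite -(ltn_pmul2r g0) -Ua -Vc.
have a0 : (0 < a)%N by move: U0; rewrite Ua muln_gt0 => /andP[].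
have gac : gcdn a c = 1%N.
  apply/eqP; rewrite -(eqn_pmul2r g0) muln_gcdl -Ua -Vc mul1n.
  exact/eqP.
have b0 : (0 < c - a)%N by rewrite subn_gt0.
have c0 : (0 < c)%N by apply: leq_trans ac.
have n0 : (0 < a * (c - a) * c)%N by rewrite !muln_gt0 a0 b0.
exists a, (c - a)%N, c; split; split => //.
- by rewrite -gcdnA (gcdnC _ c) gcdnA gac gcd1n.
- by rewrite subnKC// ltnW.
- apply: sum_omega_le => // q j pq mq jm qj.
  (* A prime above [m.+1] dividing g would divide [p + i] with [i] even and [p + k] with [k] odd,
     forcing [i = k]. So dividing U and V by g removes none of these primes. *)
  have qng : ~~ (q %| g)%N.
    apply/negP; rewrite dvdn_gcd => /andP[].
    move=> /(prime_dvd_diff_prod pq)[i [im oi qi]].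
    move=> /(prime_dvd_diff_prod pq)[k [km ok qk]].
    have ik := eq_mod_small (leq_ltn_trans im mq) (leq_ltn_trans km mq) qi qk.
    by rewrite ik ok in oi.
  have : (q %| diff_prod (odd j) m.+1 p)%N.
    apply: dvdn_trans qj _; apply: (@dvdn_prod_seq _ _ (fun i => p + i)%N).
    by rewrite diff_idx_mem jm eqxx.
  case: (odd j); rewrite -/U -/V ?Ua ?Vc Euclid_dvdM// (negbTE qng) orbF => h.
    by rewrite dvdn_mull.
  by rewrite -mulnA dvdn_mulr.
(* The primes of [a] and [c] all divide N; the radical of the remaining member [c - a] is bounded by
   that member itself. *)
- pose N := (\prod_(j <- iota 0 m.+2) (p + j))%N.
  have NM : (N <= (p + m.+1) ^ m.+2)%N.
    rewrite -[X in (_ <= _ ^ X)%N](size_iota 0 m.+2); apply: leq_prod_pow => i.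
    by rewrite mem_iota add0n ltnS leq_add2l => /andP[].
  have N0 : (0 < N)%N by apply: prod_gt0_seq => i _; lia.
  apply: leq_trans (_ : N * (c - a) <= _)%N; last by rewrite leq_mul2r NM orbT.
  apply: dvdn_leq; first by rewrite muln_gt0 N0.
  apply: gamma_dvd => // q pq.
  have qN e : (q %| diff_prod e m.+1 p)%N -> (q %| N)%N.
    move=> /(prime_dvd_diff_prod pq)[i [im _ qi]].
    apply: dvdn_trans qi _; apply: (@dvdn_prod_seq _ _ (fun i => p + i)%N).
    by rewrite mem_iota.
  rewrite !Euclid_dvdM// => /orP[/orP[qa|->]|qc]; last 2 first.
  + by rewrite orbT.
  + by rewrite (qN true)// -/V Vc dvdn_mulr.
  + by rewrite (qN false)// -/U Ua dvdn_mulr.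
- apply: leq_trans (diff_prod_ge true m p) _.
  by rewrite -/V Vc mulnC leq_mul2r orbC gcdn_diff_prod.
- apply: leq_trans (diff_prod_le true m p); rewrite -/V Vc.
  by rewrite leq_pmulr.
- by rewrite Ua Vc -mulnBl mulnCA.
Qed.

(** * Iterated differences of the logarithm *)

(** Each step is the negative of the forward difference, so that even shifts have a plus sign at
    every order, as in [diff_idx]. *)
Fixpoint fdiff (R : realType) (f : R -> R) (m : nat) (x : R) : R :=
  if m is m'.+1 then fdiff f m' x - fdiff f m' (x + 1) else f x.

Lemma fdiff_idx (R : realType) (f : R -> R) m x :
  fdiff f m x = \sum_(i <- diff_idx false m) f (x + i%:R)
              - \sum_(i <- diff_idx true m) f (x + i%:R).
Proof.
elim: m x => [|m IH] x /=; first by rewrite big_nil big_seq1 addr0 subr0.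
have shiftE b : \sum_(i <- [seq i.+1 | i <- diff_idx b m]) f (x + i%:R)
    = \sum_(i <- diff_idx b m) f (x + 1 + i%:R).
  by rewrite big_map; apply: eq_bigr => i _; rewrite -natr1; congr f; ring.
by rewrite !IH !big_cat /= !shiftE; ring.
Qed.

(** The induction step is 1/(x Q) - 1/(Q (x + m + 1)) = (m + 1)/(x Q (x + m + 1)), where Q is the
    product of the shared factors. *)
Lemma fdiff_inv (R : realType) m (x : R) : 0 < x ->
  fdiff GRing.inv m x = m`!%:R / \prod_(0 <= k < m.+1) (x + k%:R).
Proof.
elim: m x => [|m IH] x x0 /=; first by rewrite big_nat1 addr0 mul1r.
have x1 : 0 < x + 1 by rewrite ltr_wpDr.
rewrite !IH// factS natrM.
have Q0 : 0 < \prod_(0 <= k < m) (x + 1 + k%:R).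
  by apply: prodr_gt0 => k _; rewrite ltr_wpDr.
pose Q := \prod_(0 <= k < m) (x + 1 + k%:R).
have e1 : \prod_(0 <= k < m.+1) (x + k%:R) = x * Q.
  rewrite big_nat_recl//= addr0; congr (_ * _).
  by apply: eq_bigr => i _; rewrite -natr1; ring.
have e2 : \prod_(0 <= k < m.+1) (x + 1 + k%:R) = Q * (x + m.+1%:R).
  by rewrite big_nat_recr//= -natr1; congr (_ * _); ring.
rewrite [in RHS]big_nat_recr//= e1 e2.
have xm : 0 < x + m.+1%:R by rewrite ltr_wpDr.
rewrite -/Q in Q0; move: Q Q0 xm {e1 e2} => Q Q0; rewrite -natr1 => xm.
by field; rewrite !gt_eqF.
Qed.

Lemma is_derive_fdiff (R : realType) (f df : R -> R) m (x : R) :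
  (forall y : R, 0 < y -> is_derive y 1 f (df y)) -> 0 < x ->
  is_derive x 1 (fdiff f m) (fdiff df m x).
Proof.
move=> fdf; elim: m x => [|m IH] x x0 /=; first exact: fdf.
have x1 : 0 < x + 1 by rewrite ltr_wpDr.
apply: is_deriveB; first exact: IH.
rewrite -[fdiff df m (x + 1)]mulr1; apply: is_derive1_comp.
  exact: IH.
exact: is_derive_shift.
Qed.

(* One application of the mean value theorem to the [m]-th difference of [ln]
   reduces the claim to the exact formula for the differences of the inverse. *)
Lemma fdiff_ln_bounds (R : realType) m (x : R) : 0 < x ->
  - (m`!%:R / x ^+ m.+1) <= fdiff (@ln R) m.+1 x < 0.
Proof.
move=> x0; have der (z : R) : 0 < z ->
    is_derive z 1 (fdiff (@ln R) m) (fdiff GRing.inv m z).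
  by move=> z0; apply: is_derive_fdiff => // y y0; exact: is_derive1_ln.
have [|||z] := @MVT R (fdiff (@ln R) m) (fdiff GRing.inv m) x (x + 1).
- by rewrite ltrDl.
- by move=> z; rewrite in_itv /= => /andP[xz _]; apply/der/(lt_trans x0).
- apply: derivable_within_continuous => z; rewrite in_itv /= => /andP[xz _].
  by have [] := der z (lt_le_trans x0 xz).
rewrite in_itv /= => /andP[xz _]; rewrite addrAC subrr add0r mulr1 => zE.
have z0 := lt_trans x0 xz.
rewrite /= -opprB zE fdiff_inv// oppr_lt0 lerN2.
have P0 : 0 < \prod_(0 <= k < m.+1) (z + k%:R).
  by apply: prodr_gt0 => k _; rewrite ltr_wpDr.
apply/andP; split; last by rewrite divr_gt0// ltr0n fact_gt0.
rewrite ler_wpM2l// lef_pV2 ?posrE ?exprn_gt0//.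
rewrite -{1}(subn0 m.+1) -prodr_const_nat; apply: ler_prod => k _.
by rewrite (ltW x0)/= (le_trans (ltW xz))// lerDl.
Qed.

Lemma ln_prodn (R : realType) (I : eqType) (s : seq I) (F : I -> nat) :
  (forall i, i \in s -> 0 < F i)%N ->
  ln (\prod_(i <- s) F i)%N%:R = \sum_(i <- s) ln (F i)%:R :> R.
Proof.
elim: s => [|i s IH] h; first by rewrite !big_nil ln1.
have hs j : j \in s -> (0 < F j)%N by move=> js; rewrite h// inE js orbT.
rewrite !big_cons natrM lnM ?IH// posrE ltr0n ?h ?mem_head//.
exact: prod_gt0_seq.
Qed.

(** The difference of [ln] of order [m.+1] at [p] is u = ln U - ln V. With t = m!/p^(m+1), the bound
    u >= -t and exp u >= 1 + u give U >= V (1 - t). *)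
Lemma diff_prod_close (R : realType) (m p : nat)
    (U := diff_prod false m.+1 p) (V := diff_prod true m.+1 p) :
  (0 < p)%N ->
  (U < V)%N /\ ((V - U)%N%:R * p%:R ^+ m.+1 <= V%:R * m`!%:R :> R).
Proof.
move=> p0; have p0R : 0 < p%:R :> R by rewrite ltr0n.
have dp0 b : (0 < diff_prod b m.+1 p)%N by apply: prod_gt0_seq => i _; lia.
have lnE b : ln (diff_prod b m.+1 p)%:R =
    \sum_(i <- diff_idx b m.+1) ln (p%:R + i%:R) :> R.
  rewrite ln_prodn => [|i _]; last by lia.
  by apply: eq_bigr => i _; rewrite natrD.
have := fdiff_ln_bounds m p0R; rewrite fdiff_idx -!lnE -/U -/V.
have U0 : 0 < U%:R :> R by rewrite ltr0n dp0.
have V0 : 0 < V%:R :> R by rewrite ltr0n dp0.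
set t := m`!%:R / _ => /andP[lo hi].
have UV : (U < V)%N by rewrite -(ltr_nat R) -ltr_ln ?posrE// -subr_lt0.
split=> //; rewrite natrB ?(ltnW UV)//.
have -> : m`!%:R = t * p%:R ^+ m.+1 :> R.
  by rewrite /t mulfVK// gt_eqF// exprn_gt0.
rewrite mulrA ler_wpM2r ?exprn_ge0//.
have UE : U%:R = V%:R * expR (ln U%:R - ln V%:R) :> R.
  by rewrite expRB !lnK ?posrE// mulrC mulfVK// gt_eqF.
have := le_trans _ (expR_ge1Dx (ln U%:R - ln V%:R : R)).
move=> /(_ (1 - t)); rewrite lerD2l => /(_ lo) h.
rewrite lerBlDl -lerBlDr UE -[X in X - _]mulr1 -mulrBr.
by rewrite ler_wpM2l// ltW.
Qed.

(** * Logarithmic estimates *)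

Lemma nat_ln_large (R : realType) (T : R) :
  exists x0 : nat, forall x : nat, (x0 <= x)%N -> T <= ln x%:R.
Proof.
exists (Num.trunc (expR T)).+1 => x x0x.
have h : expR T < x%:R.
  by apply: lt_le_trans (truncnS_gt _) _; rewrite ler_nat.
rewrite -[T]expRK ler_ln ?posrE ?expR_gt0 ?(ltW h)//.
exact: lt_trans (expR_gt0 _) h.
Qed.

Lemma sqr_le_expR (R : realType) (l : R) : 0 <= l -> l ^+ 2 / 2 <= expR l.
Proof.
move=> l0; have := expR_ge1Dxn 1 l0; rewrite (_ : 2`!%:R = 2)//.
by apply: le_trans; rewrite lerDr.
Qed.

(** Of the slack [delta], one third is in the hypothesis, one third pays for the shift of [ln L] by
    [B], and one third for [A] and [E]. *)
Lemma absorb_constants (R : realType) (delta A B E : R) :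
  0 < delta -> 0 <= A -> 0 <= B -> 0 <= E ->
  exists L0 : R, forall L w : R, L0 <= L -> 0 <= w ->
    w * (ln L - B) <= A + (1 + delta / 3) * L ->
    w + E <= (1 + delta) * (L / ln L).
Proof.
move=> d0 A0 B0 E0.
(* The summands of [l0] are chosen for [lB], [lB2] and [lE] in turn. In [lE] the factor is
   [delta / 6] because [L2] only gives L >= l^2/2. *)
pose l0 := 1 + 2 * B + (3 / delta) * (1 + 2 * delta / 3) * B
           + (6 / delta) * (E + 2 * A).
exists (expR l0) => L w l0L w0 hw.
have L0 : 0 < L := lt_le_trans (expR_gt0 _) l0L.
set l := ln L in hw *.
have LE : L = expR l by rewrite /l lnK.
have l0l : l0 <= l by rewrite -ler_expR -LE.
have d3 : 0 < 3 / delta by rewrite divr_gt0.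
have d6 : 0 < 6 / delta by rewrite divr_gt0.
have t1 : 0 <= (3 / delta) * (1 + 2 * delta / 3) * B.
  by rewrite !mulr_ge0 ?(ltW d3)//; lra.
have t2 : 0 <= (6 / delta) * (E + 2 * A) by rewrite mulr_ge0 ?(ltW d6)//; lra.
have l1 : 1 <= l by rewrite /l0 in l0l; lra.
have lB : 2 * B + 1 <= l by rewrite /l0 in l0l; lra.
have lB2 : (1 + 2 * delta / 3) * B <= delta / 3 * l.
  rewrite -ler_pdivrMl; last by lra.
  by rewrite invf_div mulrA; rewrite /l0 in l0l; lra.
have lE : E + 2 * A <= delta / 6 * l.
  rewrite -ler_pdivrMl; last by lra.
  by rewrite invf_div; rewrite /l0 in l0l; lra.
have L2 : l ^+ 2 / 2 <= L by rewrite LE sqr_le_expR//; lra.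
have lBgt : 0 < l - B by lra.
rewrite mulrA ler_pdivlMr; last by lra.
have hl : l * (A + (1 + delta / 3) * L)
    <= (2 * A + (1 + 2 * delta / 3) * L) * (l - B).
  have h1 : 0 <= A * (l - 2 * B) by rewrite mulr_ge0//; lra.
  have h2 : 0 <= L * (delta / 3 * l - (1 + 2 * delta / 3) * B).
    by rewrite mulr_ge0// ?(ltW L0)// subr_ge0.
  by rewrite expr2 in L2 *; nra.
have hwl : w * l <= 2 * A + (1 + 2 * delta / 3) * L.
  rewrite -(ler_pM2r lBgt); apply: le_trans hl.
  by rewrite mulrAC mulrC; apply: ler_wpM2l => //; lra.
have hEl : E * l + 2 * A <= delta / 3 * L.
  have : (E + 2 * A) * l <= delta / 6 * l * l by rewrite ler_wpM2r//; lra.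
  have : 2 * A <= 2 * A * l by rewrite ler_peMr//; lra.
  by rewrite expr2 in L2; nra.
by rewrite mulrDl; lra.
Qed.

(* [p], [c], [r] below are [ln] of the homonymous quantities of the abc triple. *)
Lemma omega_log_bound (R : realType) (eps C k2 k3 k4 D p c r w : R) :
  0 < eps -> eps <= 1 -> 0 <= C -> 0 <= k2 -> 0 <= k3 -> 0 <= w ->
  0 <= D -> 0 < p -> 1 <= r -> 2 * (k4 + C) <= p ->
  c <= C + (1 + eps) * (r - w * ln r) ->
  r <= k2 + p + c -> c <= D * p + k3 -> p - k4 <= c ->
  w * (ln p - ln 4) <= C + k2 + k3 + (1 + eps * D) * p.
Proof.
move=> e0 e1 C0 k20 k30 w0 D0 p0 r1 pC hc hr hD hp.
have lr0 : 0 <= ln r by rewrite ln_ge0.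
have wl0 : 0 <= w * ln r by rewrite mulr_ge0.
(* Since [eps <= 1], [hc] gives c <= C + 2 r; moreover c >= p - k4 >= p/2 + C. *)
have rp : p / 4 <= r.
  have : 0 <= (1 - eps) * r + (1 + eps) * (w * ln r).
    by rewrite addr_ge0// mulr_ge0//; lra.
  by lra.
have lpr : ln p - ln 4 <= ln r.
  by rewrite -ln_div ?posrE// ler_ln ?posrE//; lra.
apply: le_trans (ler_wpM2l w0 lpr) _.
have e1p : 0 < 1 + eps by lra.
have ec : eps * c <= eps * (D * p + k3) by rewrite ler_wpM2l// ltW.
(* Inserting this in [hc] cancels [c] up to [eps * c], which [ec] bounds; [t1] and [t2] are the
   slack in dividing by [1 + eps]. *)
have er : (1 + eps) * r <= (1 + eps) * (k2 + p + c) by rewrite ler_wpM2l// ltW.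
have t1 : 0 <= eps * C by rewrite mulr_ge0// ltW.
have t2 : 0 <= eps * (eps * (D * p)) by rewrite !mulr_ge0// ltW.
by rewrite -(ler_pM2l e1p); lra.
Qed.

(** The conjecture gives no sign for [C], but 0 < c forces C > 0, so logarithms can be taken. The
    absolute value makes the constant nonnegative for later use. *)
Lemma abc_log_bound (R : realType) (eps C : R) (c n : nat) :
  (0 < c)%N -> (2 < gamma n)%N -> 0 < eps ->
  c%:R < C * H R n `^ (1 + eps) ->
  ln c%:R <= `|ln C| + (1 + eps) *
    (ln (gamma n)%:R - (omega n)%:R * ln (ln (gamma n)%:R)).
Proof.
move=> c0 g2 e0 h.
have g0 : 0 < (gamma n)%:R :> R by rewrite ltr0n; lia.
have lg0 : 0 < ln (gamma n)%:R :> R by rewrite ln_gt0// ltr1n; lia.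
have H0 : 0 < H R n by rewrite /H divr_gt0// exprn_gt0.
have Hp0 := powR_gt0 (1 + eps) H0.
have c0R : 0 < c%:R :> R by rewrite ltr0n.
have C0 : 0 < C by rewrite -(pmulr_lgt0 C Hp0); exact: lt_trans h.
have : ln c%:R <= ln (C * H R n `^ (1 + eps)).
  by rewrite ler_ln ?posrE ?mulr_gt0// ltW.
rewrite lnM ?posrE// ln_powR /H ln_div ?posrE ?exprn_gt0// lnXn//.
rewrite mulr_natl => /le_trans; apply.
by rewrite lerD2r ler_norm.
Qed.

(** * Application of the conjecture *)

Lemma W_diff_bound (R : realType) (abc : refined_abc_conjecture R)
    (delta : R) (m : nat) : 0 < delta ->
  exists x0 : nat, forall x : nat, (x0 <= x)%N ->
    (W x m.+2)%:R <= (1 + delta) * (ln x%:R / ln (ln x%:R)).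
Proof.
have pm x : (x.+1 + m.+1 <= m.+2 * x.+1)%N by nia.
have regroup Q X F b c p :
    (b * X <= c * F -> Q * (p * X) * b <= Q * F * p * c)%N.
  by move=> h; have := leq_mul (leqnn (Q * p)) h; lia.
move=> d0; pose D : R := (2 ^ m)%N%:R.
have D0 : 0 < D by rewrite ltr0n expn_gt0.
have D1 : 1 <= D by rewrite ler1n expn_gt0.
(* As [c] can be of size p^D, the loss c^eps must be at most about p^(delta/3). *)
pose eps := Num.min 1 (delta / 3 / D).
have e0 : 0 < eps by rewrite lt_min ltr01 !divr_gt0.
have e1 : eps <= 1 by rewrite ge_min lexx.
have eD : eps * D <= delta / 3 by rewrite -ler_pdivlMr// ge_min lexx orbT.
have [C hC] := abc eps e0.
(* [K2] comes from [gamma n <= K2 * p * c], [G] bounds gcd(U, V), and [k3] comes from c <= ((m+2)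
   p)^D. *)
pose K2 := (m.+2 ^ m.+2 * m`!)%N; pose G := (m.+1 ^ (2 ^ m * 2 ^ m))%N.
have K20 : (0 < K2)%N by rewrite muln_gt0 expn_gt0 fact_gt0.
have G0 : (0 < G)%N by rewrite expn_gt0.
pose k2 : R := ln K2%:R; pose k3 : R := D * ln m.+2%:R; pose k4 : R := ln G%:R.
have k20 : 0 <= k2 by rewrite ln_ge0// ler1n.
have k30 : 0 <= k3 by rewrite mulr_ge0 ?ln_ge0 ?ler1n// ltW.
have ln20 : 0 <= ln 2 :> R by rewrite ln_ge0// ler1n.
have ln40 : 0 <= ln 4 :> R by rewrite ln_ge0// ler1n.
(* Here [ln 2] accounts for ln p <= L + ln 2, [ln 4] for the bound ln r >= (ln p)/4, and
   [m.+2 * m.+1] for the repeated small primes. *)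
have [||L0 hL0] := @absorb_constants R delta
    (`|ln C| + k2 + k3 + (1 + delta / 3) * ln 2) (ln 4) (m.+2 * m.+1)%:R d0 _ ln40.
- by rewrite !addr_ge0 ?normr_ge0// mulr_ge0//; lra.
- exact: ler0n.
have [x0 hx0] := nat_ln_large (Num.max L0 (Num.max 1 (2 * (k4 + `|ln C|)))).
exists x0 => x /hx0; rewrite !ge_max => /and3P[LL0 L1 Lk].
set L : R := ln x%:R in LL0 L1 Lk *.
(* By convention [ln 0 = 0], so L >= 1 rules out x = 0. *)
have x1 : (0 < x)%N.
  by rewrite lt0n; apply/eqP => xE; move: L1; rewrite /L xE ln0//; lra.
have x1R : 0 < x%:R :> R by rewrite ltr0n.
(* The sum [W] starts at x + 1, so its terms are [omega (p + j)] with [j <= m.+1]. *)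
pose p := x.+1; have p0 : (0 < p)%N by [].
have p0R : 0 < p%:R :> R by rewrite ltr0n.
have LP : L <= ln p%:R by rewrite ler_ln ?posrE// ler_nat leqnSn.
have PL : ln p%:R <= L + ln 2.
  rewrite -lnM ?posrE// ler_ln ?posrE ?mulr_gt0// -natrM ler_nat.
  by rewrite muln2 -addnn /p -addn1 leq_add2l.
have [UV VUp] := diff_prod_close R m p0.
have [a [b [c [[a0 b0 gabc abcE] [hW hr hG hD bV]]]]] := abc_triple_of_diff p0 UV.
set n := (a * b * c)%N in hW hr.
have c0 : (0 < c)%N by rewrite -abcE addn_gt0 a0.
have V0 : (0 < diff_prod true m.+1 p)%N by apply: leq_trans UV.
have hb : (b * p ^ m.+1 <= c * m`!)%N.
  move: VUp; rewrite -natrX -!natrM ler_nat => VUp.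
  rewrite -(leq_pmul2r V0) mulnAC bV -!mulnA leq_mul2l (mulnC m`!).
  by rewrite VUp orbT.
(* Of the [m.+2] powers of [p], all but one are absorbed by [hb]. *)
have hr' : (gamma n <= K2 * p * c)%N.
  apply: leq_trans hr _.
  apply: (@leq_trans ((m.+2 * p) ^ m.+2 * b)%N).
    by rewrite leq_mul2r leq_exp2r// pm orbT.
  by rewrite expnMn (expnS p); exact: regroup.
have c0R : 0 < c%:R :> R by rewrite ltr0n.
have G0R : 0 < G%:R :> R by rewrite ltr0n.
have K20R : 0 < K2%:R :> R by rewrite ltr0n.
have g0 : (0 < gamma n)%N by rewrite (leq_trans _ (gamma_ge_pow2 n))// expn_gt0.
have g0R : 0 < (gamma n)%:R :> R by rewrite ltr0n.
have lr : ln (gamma n)%:R <= k2 + ln p%:R + ln c%:R :> R.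
  rewrite /k2 -!lnM ?posrE ?mulr_gt0// ler_ln ?posrE ?mulr_gt0//.
  by rewrite -!natrM ler_nat.
have lD : ln c%:R <= D * ln p%:R + k3 :> R.
  have : ln c%:R <= ln ((m.+2 * p)%N%:R ^+ (2 ^ m)) :> R.
    rewrite ler_ln ?posrE ?exprn_gt0 ?ltr0n// -natrX ler_nat.
    apply: leq_trans hD _; by rewrite leq_exp2r ?expn_gt0// pm.
  move=> /le_trans; apply; rewrite lnXn ?ltr0n// natrM lnM ?posrE ?ltr0n//.
  by rewrite -[_ *+ (2 ^ m)]mulr_natl -/D mulrDr addrC.
have lG : ln p%:R - k4 <= ln c%:R :> R.
  rewrite lerBlDl /k4 -lnM ?posrE// ler_ln ?posrE ?mulr_gt0//.
  rewrite -natrM ler_nat; apply: leq_trans hG.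
  by rewrite -{1}(expn1 p) leq_pexp2l// expn_gt0.
have Wle : (W x m.+2)%:R <= (omega n)%:R + (m.+2 * m.+1)%:R :> R.
  rewrite -natrD ler_nat; apply: leq_trans hW.
  rewrite /W big_add1 /= leq_eqVlt; apply/orP; left; apply/eqP.
  by apply: eq_bigr => j _; rewrite /p addSnnS.
apply: le_trans Wle _; apply: hL0 => //.
have dL : 0 <= delta * L by rewrite mulr_ge0//; lra.
have d2 : 0 <= (1 + delta / 3) * ln 2 :> R by rewrite mulr_ge0//; lra.
have C0 := normr_ge0 (ln C).
(* Two primes make the radical at least 4 and its logarithm at least 1; with fewer, ln L <= L
   suffices. *)
have [w2|w2] := ltnP 1 (omega n); last first.
  have lL : ln L <= L by rewrite ltW// ln_sublinear//; lra.
  case: (omega n) w2 => [|[|//]] _; rewrite ?mul0r ?mul1r; lra.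
have g4 : (4 <= gamma n)%N.
  by apply: leq_trans (gamma_ge_pow2 n); rewrite (@leq_exp2l 2 2).
have lr1 : 1 <= ln (gamma n)%:R :> R.
  have ln2 : 1 / 2 <= ln 2 :> R.
    have := @le_ln1Dx R (- (1 / 2)); rewrite (_ : 1 - 1 / 2 = 2^-1); last by lra.
    by rewrite lnV ?posrE// lerN2; apply; lra.
  have : ln (2 ^+ 2) <= ln (gamma n)%:R :> R.
    by rewrite ler_ln ?posrE ?exprn_gt0// -natrX ler_nat.
  by rewrite lnXn//; lra.
have hc : c%:R < C * H R n `^ (1 + eps) by apply: hC => //.
have := omega_log_bound e0 e1 C0 k20 k30 (ler0n _ _) (ltW D0) _ lr1 _
          (abc_log_bound c0 _ e0 hc) lr lD lG.
have P0 : 0 < ln p%:R :> R by lra.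
move=> /(_ P0 (le_trans Lk LP) (ltnW g4)) hw.
have lLP : ln L <= ln (ln p%:R) by rewrite ler_ln ?posrE//; lra.
have : (omega n)%:R * (ln L - ln 4) <= (omega n)%:R * (ln (ln p%:R) - ln 4) :> R.
  by rewrite ler_wpM2l// lerD2r.
move=> /le_trans; apply; apply: le_trans hw _.
have : (1 + eps * D) * ln p%:R <= (1 + delta / 3) * (L + ln 2).
  by apply: ler_pM => //; rewrite ?addr_ge0 ?mulr_ge0 ?lerD2l//; lra.
by lra.
Qed.

Lemma W_monotone (x y z : nat) : (y <= z)%N -> (W x y <= W x z)%N.
Proof. by move=> yz; rewrite /W [in leqRHS](@big_cat_nat _ _ _ y.+1)// leq_addr. Qed.

Theorem theorem1 (R : realType) (abc : refined_abc_conjecture R)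
    (delta : R) (delta_gt0 : 0 < delta) (y : nat) (y_ge1 : (1 <= y)%N) :
  exists x0 : nat, forall x : nat, (x0 <= x)%N ->
    (W x y)%:R <= (1 + delta) * (ln x%:R / ln (ln x%:R)).
Proof.
(* This bounds the sum of length [y.+1], which dominates the one of length [y]. *)
have [x0 hx0] := W_diff_bound abc y.-1 delta_gt0.
exists x0 => x /hx0; apply: le_trans; rewrite ler_nat W_monotone//; lia.
Qed.
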